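(* Let $H \leq S_n$. Up to equivalence, there is a unique finest disjoint direct product decomposition of $H$.
   Context: For a permutation group $G$, $\mathrm{Supp}(G)$ is the set of points moved by some element of $G$. $H = H_1 \times H_2 \times \cdots \times H_r$ is a disjoint direct product decomposition of $H$ if it is a direct product decomposition of $H$ (into subgroups $H_i\leq H$) and the groups $H_i$ have pairwise disjoint supports; each $H_i$ fixes all points outside $\mathrm{Supp}(H_i)$. Convention: if $r>1$, all factors $H_i$ are nontrivial. A permutation group is d.d.p. decomposable if it has a disjoint direct product decomposition with $r>1$, and d.d.p. indecomposable otherwise. A disjoint direct product decomposition is finest if each of its factors is d.d.p. indecomposable. Two disjoint direct product decompositions $H = H_1\times \cdots\times H_r$ and $H=K_1\times\cdots\times K_s$ are equivalent if the sets $\{\mathrm{Supp}(H_i)\mid 1\leq i\leq r\}$ and $\{\mathrm{Supp}(K_i)\mid 1\leq i\leq s\}$ are equal. *)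

(* Defs.v *)
From mathcomp Require Import all_boot all_fingroup.

Set Implicit Arguments.
Unset Strict Implicit.
Unset Printing Implicit Defensive.

Import GroupScope.

Section DisjointDirectProducts.

Variable T : finType.
Implicit Types G H : {group {perm T}}.

Definition Supp G : {set T} := [set x | [exists g in G, g x != x]].

(* At least one factor is required: a trivial group has the one-factor
   decomposition consisting of itself, and no other. *)
Record is_ddp H r (Hs : 'I_r -> {group {perm T}}) : Prop := IsDdp {
  ddp_gt0 : 0 < r;
  ddp_dprod : \big[dprod/1]_(i < r) Hs i = H;
  ddp_disjoint : forall i j, i != j -> [disjoint Supp (Hs i) & Supp (Hs j)];
  ddp_nontrivial : 1 < r -> forall i, Hs i :!=: 1
}.

Definition ddp_decomposable H : Prop :=
  exists (r : nat) (Hs : 'I_r -> {group {perm T}}), is_ddp H Hs /\ 1 < r.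

Definition ddp_indecomposable H : Prop := ~ ddp_decomposable H.

Definition is_finest_ddp H r (Hs : 'I_r -> {group {perm T}}) : Prop :=
  is_ddp H Hs /\ forall i, ddp_indecomposable (Hs i).

Definition ddp_equivalent r (Hs : 'I_r -> {group {perm T}})
    s (Ks : 'I_s -> {group {perm T}}) : Prop :=
  [set Supp (Hs i) | i : 'I_r] = [set Supp (Ks j) | j : 'I_s].

End DisjointDirectProducts.

(* Main.v *)
Require Import Defs.
From mathcomp Require Import all_boot all_fingroup.

(** A disjoint direct product decomposition of a nontrivial group [H] is the
    same thing as a partition of [Supp H] into sets [D] that split [H]: for
    every [h] in [H], the permutation acting as [h] on [D] and as the identity
    elsewhere is again in [H]. Given such a partition, the factor attached to
    the part [D] is the rigid stabiliser of [D], the subgroup of the elements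
    of [H] fixing every point outside [D]. Given a decomposition, the factor
    with support [D] contributes to the product of an [h] in [H] exactly the
    restriction of [h] to [D], so that [D] splits [H].

    The sets splitting [H] form a Boolean algebra of subsets of the ground set
    ([splits_setI], [splits_setC]), and its atoms inside [Supp H], called
    blocks here, partition [Supp H] ([block_disjoint], [block_cover]). A
    factor is indecomposable exactly when its support is a block, because a
    smaller nonempty splitting set would split the factor further
    ([block_indecomposable], [indecomposable_block]).

    Hence the rigid stabilisers of the blocks form a finest decomposition,
    and the supports of any finest decomposition are all the blocks, each
    block being met by some support. The trivial group has no block and is
    treated apart: it only has the decomposition with itself as sole factor. *)

Section FinestDecomposition.

Set Implicit Arguments.
Unset Strict Implicit.

Import GroupScope.

Variable T : finType.
Implicit Types (G H K : {group {perm T}}) (B D E : {set T}).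

(** * Supports, rigid stabilisers and splitting sets *)

Lemma SuppP H x : reflect (exists2 h, h \in H & h x != x) (x \in Supp H).
Proof. by rewrite inE; apply: exists_inP. Qed.

Lemma SuppPn H h x : h \in H -> x \notin Supp H -> h x = x.
Proof. by move=> Hh /SuppP nHx; apply/eqP/negPn/negP=> hx; case: nHx; exists h. Qed.

Lemma Supp_stable H h x : h \in H -> (h x \in Supp H) = (x \in Supp H).
Proof.
move=> Hh; case: (boolP (x \in Supp H)) => [/SuppP[g Hg gx] | nHx].
  apply/SuppP; exists (g ^ h); first by rewrite groupJ.
  by rewrite conjgE !permM permK (inj_eq perm_inj).
by rewrite (SuppPn Hh nHx) (negPf nHx).
Qed.

Lemma SuppS G H : G \subset H -> Supp G \subset Supp H.
Proof.
move/subsetP=> sGH; apply/subsetP=> x /SuppP[g Gg gx].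
by apply/SuppP; exists g; first exact: sGH.
Qed.

Lemma Supp_eq0 H : (Supp H == set0) = (H :==: 1).
Proof.
apply/eqP/eqP=> [H0 | H1].
  apply/trivgP/subsetP=> h Hh; rewrite inE; apply/eqP/permP=> x.
  by rewrite perm1 (SuppPn Hh) // H0 inE.
apply/setP=> x; rewrite in_set0; apply/SuppP=> -[h].
by rewrite H1 inE => /eqP->; rewrite perm1 eqxx.
Qed.

Definition rigid_stab H D : {group {perm T}} := 'C_H(~: D | 'P)%G.

Lemma rigid_stabP H D h :
  reflect (h \in H /\ forall x, x \notin D -> h x = x) (h \in rigid_stab H D).
Proof.
apply: (iffP setIP) => -[Hh fixh]; split=> //.
  by move=> x Dx; have /= := astab_act fixh; apply; rewrite inE.
by apply/astabP=> x; rewrite inE; apply: fixh.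
Qed.

Definition splits H D :=
  [forall h in H, [exists g in H,
     [forall x, g x == if x \in D then h x else x]]].

Lemma splitsP H D :
  reflect (forall h, h \in H ->
             exists2 g, g \in H & forall x, g x = if x \in D then h x else x)
          (splits H D).
Proof.
apply: (iffP forall_inP) => spl h Hh.
  by have /exists_inP[g Hg /forallP gE] := spl h Hh; exists g => // x; apply/eqP.
have [g Hg gE] := spl h Hh; apply/exists_inP; exists g => //.
by apply/forallP=> x; apply/eqP.
Qed.

Lemma splits_Supp H : splits H (Supp H).
Proof.
apply/splitsP=> h Hh; exists h => // x.
by case: ifPn => // /(SuppPn Hh).
Qed.

Lemma splits_setI H D E : splits H D -> splits H E -> splits H (D :&: E).
Proof.
move=> /splitsP splD /splitsP splE; apply/splitsP=> h Hh.
have [g /splE[k Hk kE] gE] := splD h Hh; exists k => // x.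
by rewrite kE gE inE andbC; case: (x \in E).
Qed.

(** With [g] the restriction of [h] to [D], the restriction of [h] to the
    complement of [D] is the quotient of [h] by [g]. *)
Lemma splits_setC H D : splits H D -> splits H (~: D).
Proof.
move=> /splitsP splD; apply/splitsP=> h Hh; have [g Hg gE] := splD h Hh.
exists (g^-1 * h) => [|x]; first by rewrite groupM ?groupV.
rewrite permM inE; have [Dx | Dx] /= := boolP (x \in D); last first.
  by congr (h _); apply/(canLR (permK g)); rewrite gE (negPf Dx).
have := gE (g^-1 x); rewrite permKV; case: ifP => [_ <- // | nD xE].
by rewrite xE nD in Dx.
Qed.

Lemma splits_setD H D E : splits H D -> splits H E -> splits H (D :\: E).
Proof. by move=> splD splE; rewrite setDE splits_setI ?splits_setC. Qed.

Lemma Supp_rigid_stab H D :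
  splits H D -> D \subset Supp H -> Supp (rigid_stab H D) = D.
Proof.
move=> /splitsP splD /subsetP sDH; apply/setP=> x; apply/SuppP/idP.
  by case=> h /rigid_stabP[_ fixh]; apply: contraR => /fixh->.
move=> Dx; have /SuppP[h Hh hx] := sDH x Dx; have [g Hg gE] := splD h Hh.
exists g; last by rewrite gE Dx.
by apply/rigid_stabP; split=> // y Dy; rewrite gE (negPf Dy).
Qed.

(** Restricting an element of [H] to a part of [D] can be done in two steps,
    first to [D], which lands in the rigid stabiliser. *)
Lemma splits_rigid_stab H D E :
  splits H D -> E \subset D -> splits (rigid_stab H D) E = splits H E.
Proof.
move=> /splitsP splD /subsetP sED; apply/splitsP/splitsP=> splE h.
  move=> /splD[g Hg gE]; case: (splE g) => [|k /rigid_stabP[Hk _] kE].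
    by apply/rigid_stabP; split=> // x Dx; rewrite gE (negPf Dx).
  by exists k => // x; rewrite kE gE; case: ifP => // /sED->.
case/rigid_stabP=> Hh fixh; have [k Hk kE] := splE h Hh; exists k => //.
apply/rigid_stabP; split=> // x Dx.
by rewrite kE; case: ifP => // _; apply: fixh.
Qed.

(** * Decompositions as partitions into splitting sets *)

(** At most one factor of the product moves a point of the support of [k j],
    and it keeps that point inside this support. *)
Lemma prod_disjoint_supports (I : finType) (K : I -> {group {perm T}})
    (k : I -> {perm T}) (r : seq I) j x :
    (forall i j, i != j -> [disjoint Supp (K i) & Supp (K j)]) ->
    (forall i, k i \in K i) -> uniq r -> x \in Supp (K j) ->
  (\prod_(i <- r) k i) x = if j \in r then k j x else x.
Proof.
move=> disK Kk; elim: r x => [|i r IHr] x /=; first by rewrite big_nil perm1.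
case/andP=> nri Ur Kx; rewrite big_cons permM inE.
have [eq_ji | ne_ji] /= := eqVneq j i.
  by subst j; rewrite IHr ?Supp_stable // (negPf nri).
rewrite (SuppPn (Kk i)); first exact: IHr.
by rewrite (disjointFr (disK _ _ ne_ji)).
Qed.

(** Every factor fixes the support of [K i] pointwise, except [K i] itself, so
    the other factors generate a group that centralises [K i] and meets it
    trivially. *)
Lemma dprod_disjoint_supports (I : finType) (K : I -> {group {perm T}}) :
    (forall i j, i != j -> [disjoint Supp (K i) & Supp (K j)]) ->
  \big[dprod/1]_i K i = (\prod_i K i)%G.
Proof.
move=> disK; apply/eqP/bigdprodYP=> i _.
set P := (\prod_(j | _) _)%G.
have fixP: P \subset 'C(Supp (K i) | 'P).
  rewrite /P bigprodGE gen_subG; apply/bigcupsP=> j /= ne_ji.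
  apply/subsetP=> g Kg; apply/astabP=> x Kx.
  by apply: (SuppPn Kg); rewrite (disjointFl (disK _ _ ne_ji)).
have cenP: P \subset 'C(K i).
  rewrite /P bigprodGE gen_subG; apply/bigcupsP=> j /= ne_ji.
  apply/centsP=> g Kg h Kh; apply/permP=> x; rewrite !permM.
  have nKi y : y \in Supp (K j) -> y \notin Supp (K i).
    by move=> Ky; rewrite (disjointFr (disK _ _ ne_ji)).
  have [Kx | Kx] := boolP (x \in Supp (K j)).
    by rewrite !(SuppPn Kh) ?nKi ?Supp_stable.
  have [Kix | Kix] := boolP (x \in Supp (K i)); last first.
    by rewrite (SuppPn Kh Kix) (SuppPn Kg Kx) (SuppPn Kh Kix).
  rewrite !(SuppPn Kg) //; apply: contraL Kix => /nKi.
  by rewrite Supp_stable.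
apply/subsetP=> g Pg; rewrite inE (subsetP cenP) // andbT.
apply/negP=> /setD1P[/eqP nt_g Kg]; case: nt_g; apply/permP=> x; rewrite perm1.
have [Kx | /SuppPn-> //] := boolP (x \in Supp (K i)).
exact: (astab_act (subsetP fixP g Pg) Kx).
Qed.

(** An element of [H] is the product of its restrictions to the sets [B i],
    as can be checked on each point of [Supp H]. *)
Lemma ddp_of_splits H r (B : 'I_r -> {set T}) :
    0 < r -> (forall i, splits H (B i)) -> (forall i, B i \subset Supp H) ->
    (forall i, B i != set0) -> (forall i j, i != j -> [disjoint B i & B j]) ->
    Supp H \subset \bigcup_i B i ->
  is_ddp H (fun i => rigid_stab H (B i)).
Proof.
move=> r_gt0 splB sBH ntB disB /subsetP covB.
have SuppB i: Supp (rigid_stab H (B i)) = B i by apply: Supp_rigid_stab.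
have disK i j: i != j ->
  [disjoint Supp (rigid_stab H (B i)) & Supp (rigid_stab H (B j))].
  by rewrite !SuppB; apply: disB.
split=> // [|_ i]; last by rewrite -Supp_eq0 SuppB.
rewrite dprod_disjoint_supports //; apply/eqP; rewrite eqEsubset.
rewrite {1}bigprodGE gen_subG; apply/andP; split.
  by apply/bigcupsP=> i _; apply: subsetIl.
apply/subsetP=> h Hh.
have /fin_all_exists[k kP]: forall i, exists g, g \in rigid_stab H (B i) /\
  forall x, x \in B i -> g x = h x.
- move=> i; have /splitsP/(_ h Hh)[g Hg gE] := splB i; exists g.
  split=> [|x Bx]; last by rewrite gE Bx.
  by apply/rigid_stabP; split=> // x /negPf Bx; rewrite gE Bx.
have Kk i : k i \in rigid_stab H (B i) by case: (kP i).
suffices -> : h = \prod_i k i.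
  apply: group_prod => i _; rewrite bigprodGE mem_gen //.
  by apply/bigcupP; exists i.
apply/permP=> x; have [Hx | Hx] := boolP (x \in Supp H).
  have /bigcupP[i _ Bx] := covB x Hx.
  rewrite (prod_disjoint_supports (j := i) disK Kk) ?index_enum_uniq ?SuppB //.
  by rewrite mem_index_enum (proj2 (kP i)).
rewrite (SuppPn Hh Hx) (SuppPn (H := H)) //; apply: group_prod => i _.
by case/rigid_stabP: (Kk i).
Qed.

Section Factors.

Variables (H : {group {perm T}}) (r : nat) (K : 'I_r -> {group {perm T}}).
Hypothesis ddpK : is_ddp H K.

Lemma ddp_factor_sub i : K i \subset H.
Proof.
by rewrite -(bigdprodWY (ddp_dprod ddpK)) sub_gen // (bigcup_sup i).
Qed.

(** The restriction of [h] to the support of a factor is the component of [h]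
    in that factor. *)
Lemma ddp_restrict h i :
    h \in H ->
  exists2 g, g \in K i & forall x, x \in Supp (K i) -> g x = h x.
Proof.
move=> Hh; have [k [Kk -> _]] := mem_bigdprod (ddp_dprod ddpK) Hh.
exists (k i) => [|x Kx]; first exact: Kk.
have Kk' j : k j \in K j by apply: Kk.
rewrite (prod_disjoint_supports (j := i) (ddp_disjoint ddpK) Kk') //.
  by rewrite mem_index_enum.
exact: index_enum_uniq.
Qed.

Lemma ddp_splits i : splits H (Supp (K i)).
Proof.
apply/splitsP=> h Hh; have [g Kg gE] := ddp_restrict i Hh.
exists g => [|x]; first exact: subsetP (ddp_factor_sub i) g Kg.
by case: ifPn => [/gE | /(SuppPn Kg)].
Qed.

Lemma ddp_factorE i : K i = rigid_stab H (Supp (K i)).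
Proof.
apply/group_inj/eqP; rewrite eqEsubset; apply/andP; split; apply/subsetP=> h.
  move=> Kh; apply/rigid_stabP; split; last by move=> x /(SuppPn Kh).
  exact: subsetP (ddp_factor_sub i) h Kh.
case/rigid_stabP=> /(ddp_restrict i)[g Kg gE] fixh.
suffices ->: h = g by [].
apply/permP=> x; have [/gE // | Kx] := boolP (x \in Supp (K i)).
by rewrite (SuppPn Kg Kx) fixh.
Qed.

Lemma ddp_Supp_cover : Supp H \subset \bigcup_i Supp (K i).
Proof.
apply/subsetP=> x /SuppP[h Hh]; apply: contraR => nKx; apply/eqP.
have [k [Kk -> _]] := mem_bigdprod (ddp_dprod ddpK) Hh.
apply: (big_ind (fun g : {perm T} => g x = x)) => [|g g' gx g'x|i _].
- by rewrite perm1.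
- by rewrite permM gx.
apply: (SuppPn (Kk i isT)); apply: contra nKx => Kx.
by apply/bigcupP; exists i.
Qed.

End Factors.

(** * Blocks and indecomposability *)

Definition block H : pred {set T} :=
  minset (fun D => [&& splits H D, D != set0 & D \subset Supp H]).

Lemma blockP H D :
  reflect [/\ splits H D, D != set0, D \subset Supp H &
             forall E, splits H E -> E != set0 -> E \subset D -> E = D]
          (block H D).
Proof.
apply: (iffP minsetP) => [[/and3P[splD ntD sDH] minD] | [splD ntD sDH minD]].
  split=> // E splE ntE sED; apply: minD => //.
  by rewrite splE ntE (subset_trans sED).
by split=> [|E /and3P[splE ntE _]]; [apply/and3P | apply: minD].
Qed.

Lemma block_sub_or_disjoint H B D :
  block H B -> splits H D -> [disjoint B & D] \/ B \subset D.
Proof.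
case/blockP=> splB ntB sBH minB splD.
have [|ntI] := eqVneq (B :&: D) set0.
  by move/eqP; rewrite setI_eq0; left.
by right; apply/setIidPl/minB; rewrite ?splits_setI ?subsetIl.
Qed.

Lemma block_disjoint H B D :
  block H B -> block H D -> B != D -> [disjoint B & D].
Proof.
move=> blB blD; have /blockP[splD _ _ minD] := blD.
case: (block_sub_or_disjoint blB splD) => // sBD.
by case/blockP: blB => splB ntB _ _; rewrite (minD B) // eqxx.
Qed.

(** The block of [x] is a minimal splitting set containing [x]: a splitting
    subset missing [x] could be removed from it. *)
Lemma block_cover H x : x \in Supp H -> exists2 B, block H B & x \in B.
Proof.
move=> Hx; pose P D := splits H D && (x \in D).
have [|D /minsetP[/andP[splD Dx] minD] sDH] := @minset_exists _ P (Supp H).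
  by rewrite /P splits_Supp.
exists D => //; apply/blockP; split=> //; first by apply/set0Pn; exists x.
move=> E splE /set0Pn[y Ey] sED; have [Ex | nEx] := boolP (x \in E).
  by apply: minD => //; apply/andP.
have DE: D :\: E = D.
  by apply: minD; rewrite ?subsetDl // /P splits_setD // inE nEx.
by have := subsetP sED y Ey; rewrite -DE inE Ey.
Qed.

(** The supports of the factors of a decomposition of the rigid stabiliser
    split [H] and lie in [B], so by minimality they all equal [B]; being
    disjoint, there cannot be two of them. *)
Lemma block_indecomposable H B :
  block H B -> ddp_indecomposable (rigid_stab H B).
Proof.
case/blockP=> splB ntB sBH minB [r [K [ddpK r_gt1]]].
have SuppB := Supp_rigid_stab splB sBH.
have SuppK i: Supp (K i) = B.
  have sKB: Supp (K i) \subset B by rewrite -SuppB SuppS // (ddp_factor_sub ddpK).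
  apply: minB => //; last by rewrite Supp_eq0 (ddp_nontrivial ddpK).
  by rewrite -(splits_rigid_stab splB sKB) (ddp_splits ddpK).
have := ddp_disjoint ddpK (_ : Ordinal (ltnW r_gt1) != Ordinal r_gt1) => /(_ isT).
by rewrite !SuppK -setI_eq0 setIid (negPf ntB).
Qed.

(** A smaller splitting set and its complement in the support would decompose
    the rigid stabiliser into two factors. *)
Lemma indecomposable_block H D :
    splits H D -> D != set0 -> D \subset Supp H ->
  ddp_indecomposable (rigid_stab H D) -> block H D.
Proof.
move=> splD ntD sDH indD; apply/blockP; split=> // E splE ntE sED.
apply/eqP; rewrite eqEsubset sED -setD_eq0; apply/negPn/negP=> ntDE.
have SuppD := Supp_rigid_stab splD sDH.
case: indD; pose B (i : 'I_2) := if i == ord0 then E else D :\: E.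
exists 2, (fun i => rigid_stab (rigid_stab H D) (B i)); split=> //.
have sBD i: B i \subset D by rewrite /B; case: ifP => // _; apply: subsetDl.
have disE: [disjoint E & D :\: E].
  by rewrite -setI_eq0 setIDA setDE -setIA setICA setICr !setI0.
apply: ddp_of_splits => // [i|i|i|i j|]; rewrite ?SuppD //.
- by rewrite splits_rigid_stab // /B; case: ifP => // _; apply: splits_setD.
- by rewrite /B; case: ifP.
- by case: i j => [[|[|//]] ?] [[|[|//]] ?] // _; rewrite /B /= 1?disjoint_sym.
apply/subsetP=> x Dx; apply/bigcupP.
have [Ex | nEx] := boolP (x \in E); first by exists ord0.
by exists ord_max; rewrite // /B /= inE nEx.
Qed.

(** * Existence and uniqueness *)

Lemma trivial_ddp H : is_ddp H (fun _ : 'I_1 => H).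
Proof.
split=> // [|i j]; first by rewrite big_ord1.
by rewrite !ord1.
Qed.

Lemma trivg_indecomposable H : H :=: 1 -> ddp_indecomposable H.
Proof.
move=> H1 [r [K [ddpK r_gt1]]].
case/negP: (ddp_nontrivial ddpK r_gt1 (Ordinal r_gt1)).
by rewrite -subG1 -H1 (ddp_factor_sub ddpK).
Qed.

Lemma ddp_Supp_trivg H r (K : 'I_r -> {group {perm T}}) :
  H :=: 1 -> is_ddp H K -> [set Supp (K i) | i : 'I_r] = [set set0].
Proof.
move=> H1 ddpK; have K0 i: Supp (K i) = set0.
  by apply/eqP; rewrite Supp_eq0 -subG1 -H1 (ddp_factor_sub ddpK).
apply/setP=> D; rewrite inE; apply/imsetP/eqP => [[i _ ->] // | ->].
by exists (Ordinal (ddp_gt0 ddpK)).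
Qed.

(** The right-hand side depends on [H] alone, which is the uniqueness for
    nontrivial groups. *)
Lemma finest_ddp_Supp H r (K : 'I_r -> {group {perm T}}) :
    H :!=: 1 -> is_finest_ddp H K ->
  [set Supp (K i) | i : 'I_r] = [set D | block H D].
Proof.
move=> ntH [ddpK indK].
have sKH i: Supp (K i) \subset Supp H by rewrite SuppS ?(ddp_factor_sub ddpK).
have covK := subsetP (ddp_Supp_cover ddpK).
have ntK i: Supp (K i) != set0.
  (* A sole factor may be trivial a priori, but then so would [H] be. *)
  have [r_gt1 | r_le1] := ltnP 1 r.
    by rewrite Supp_eq0 (ddp_nontrivial ddpK).
  move: ntH; rewrite -Supp_eq0 => /set0Pn[x /covK/bigcupP[j _ Kx]].
  apply/set0Pn; exists x; suffices ->: i = j by [].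
  have val0 (k : 'I_r): val k = 0%N.
    by apply/eqP; rewrite -leqn0 -ltnS (leq_trans (ltn_ord k)).
  by apply: val_inj; rewrite !val0.
have blK i: block H (Supp (K i)).
  apply: indecomposable_block; rewrite // ?(ddp_splits ddpK) //.
  by rewrite -(ddp_factorE ddpK).
apply/setP=> D; rewrite inE; apply/imsetP/idP=> [[i _ ->] // | blD].
have /blockP[_ /set0Pn[x Dx] sDH _] := blD.
have /bigcupP[i _ Kx] := covK x (subsetP sDH x Dx); exists i => //.
apply/eqP/negPn/negP=> /(block_disjoint blD (blK i))/disjointFr/(_ Dx).
by rewrite Kx.
Qed.

Lemma finest_ddp_exists H :
  exists r (K : 'I_r -> {group {perm T}}), is_finest_ddp H K.
Proof.
have [H1 | ntH] := eqVneq (H : {set _}) 1.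
  exists 1%N, (fun _ => H); split; first exact: trivial_ddp.
  by move=> _; apply: trivg_indecomposable.
pose S := [set D | block H D].
have blS (i : 'I_#|S|): block H (enum_val i).
  by have := enum_valP i; rewrite inE.
exists #|S|, (fun i => rigid_stab H (enum_val i)); split; last first.
  by move=> i; apply: block_indecomposable.
apply: ddp_of_splits => [|i|i|i|i j ne_ij|]; try by case/blockP: (blS i).
- move: ntH; rewrite -Supp_eq0 => /set0Pn[x /block_cover[B blB _]].
  by apply/card_gt0P; exists B; rewrite inE.
- by apply: (block_disjoint (blS i) (blS j)); rewrite (inj_eq enum_val_inj).
apply/subsetP=> x /block_cover[B blB Bx].
have SB: B \in S by rewrite inE.
by apply/bigcupP; exists (enum_rank_in SB B); rewrite ?enum_rankK_in.
Qed.

Lemma finest_ddp_unique H r (K : 'I_r -> {group {perm T}})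
    s (L : 'I_s -> {group {perm T}}) :
  is_finest_ddp H K -> is_finest_ddp H L -> ddp_equivalent K L.
Proof.
rewrite /ddp_equivalent; have [H1 | ntH] := eqVneq (H : {set _}) 1.
  by case=> ddpK _ [ddpL _]; rewrite !(ddp_Supp_trivg H1).
by move=> finK finL; rewrite !(finest_ddp_Supp ntH).
Qed.

End FinestDecomposition.

Theorem proposition3p2 (n : nat) (H : {group 'S_n}) :
  exists (r : nat) (Hs : 'I_r -> {group 'S_n}),
    is_finest_ddp H Hs /\
    forall (s : nat) (Ks : 'I_s -> {group 'S_n}),
      is_finest_ddp H Ks -> ddp_equivalent Hs Ks.
Proof.
have [r [K finK]] := finest_ddp_exists H.
exists r, K; split=> // s L; exact: finest_ddp_unique finK.
Qed.
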